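(* Let $Y_{N,k}^{\mathrm{cl}}$ be the finite-dimensional reduced clean package space, $G_{\Lambda,k}^{\mathrm{cl}}\subset Y_{N,k}^{\mathrm{cl}}$ the clean gauge subspace, $M_{\Lambda,k}^{\mathrm{PFE}}$ the pressure--flux--energy (PFE) clean detector and $T_{\Lambda,k}^{\mathrm{PFE}}:Y_{N,k}^{\mathrm{cl}}\to Z_{\Lambda,k}^{\mathrm{PFE}}$ the combined linear detector/tax map. Assume all PFE detector channels are nonnegative, all active weights are positive, and $$\ker T_{\Lambda,k}^{\mathrm{PFE}}=G_{\Lambda,k}^{\mathrm{cl}}.$$ Then for every $D_k^{\mathrm{cl}}\in Y_{N,k}^{\mathrm{cl}}$, $$M_{\Lambda,k}^{\mathrm{PFE}}(D_k^{\mathrm{cl}})=0\quad\Longrightarrow\quad D_k^{\mathrm{cl}}\in G_{\Lambda,k}^{\mathrm{cl}}.$$ Equivalently, $\{D_k^{\mathrm{cl}}\in Y_{N,k}^{\mathrm{cl}}:M_{\Lambda,k}^{\mathrm{PFE}}(D_k^{\mathrm{cl}})=0\}\subset G_{\Lambda,k}^{\mathrm{cl}}$.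
   Context: A reduced PFE clean package is $D_k^{\mathrm{cl}}=(p_k^{\mathrm{act},\mathrm{cl}},p_k^{\mathrm{harm},\mathrm{cl}},F_k^{\mathrm{cl}},\mathcal F_k^{\mathrm{flux}},\mathcal E_k^{\mathrm{en}},G_k^{\mathrm{cl}},O_k^{\mathrm{cl}})\in Y_{N,k}^{\mathrm{cl}}$ (active pressure, harmonic pressure, source, flux, energy, gate, observation coordinates). The detector is $$M_{\Lambda,k}^{\mathrm{PFE}}(D)=\|O_k^{\mathrm{cl}}(D)\|_{\mathcal O}+\beta_{\mathrm{prs}}\|T_{\mathrm{prs}}D\|+\beta_{\mathrm{harm}}\|T_{\mathrm{harm}}D\|+\beta_{\mathrm{flux}}\|T_{\mathrm{flux}}D\|+\beta_{\mathrm{en}}\|T_{\mathrm{en}}D\|+\beta_{\mathrm{gate}}\|T_{\mathrm{gate}}D\|,$$ with $T_{\mathrm{prs}}D=(I-\Pi_{J,k}^{\mathrm{prs}})p_k^{\mathrm{act},\mathrm{cl}}$, $T_{\mathrm{harm}}D=(I-\Pi_{M,k}^{\mathrm{harm}})p_k^{\mathrm{harm},\mathrm{cl}}$ for fixed finite-rank selectors $\Pi$ (norms in $L^{3/2}((-1,0);L^{3/2}(B_{1/2}))$ and $L^{3/2}((-1,0);L^{3/2}(B_{3/4}))$ respectively), and $T_{\mathrm{flux}},T_{\mathrm{en}},T_{\mathrm{gate}}$ fixed linear maps to finite-dimensional normed spaces. $T_{\Lambda,k}^{\mathrm{PFE}}D=(O_k^{\mathrm{cl}}(D),T_{\mathrm{prs}}D,T_{\mathrm{harm}}D,T_{\mathrm{flux}}D,T_{\mathrm{en}}D,T_{\mathrm{gate}}D)$;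 all components are linear and all of these channels are active (positive weights). *)

(* Defs.v *)
From HB Require Import structures.
From mathcomp Require Import all_boot all_order all_algebra generic_quotient.
From mathcomp Require Import all_classical all_reals ereal topology normedtype.
From mathcomp Require Import sequences exp measure measurable_realfun.
From mathcomp Require Import ess_sup_inf.
From mathcomp Require Import lebesgue_measure lebesgue_integral hoelder.

Set Implicit Arguments.
Unset Strict Implicit.
Unset Printing Implicit Defensive.

Import Order.TTheory GRing.Theory Num.Theory.
Import numFieldNormedType.Exports.

Local Open Scope classical_set_scope.
Local Open Scope ring_scope.

Lemma ae_eq_Lnorm d (T : measurableType d) (R : realType)
    (mu : {measure set T -> \bar R}) (p : \bar R) (f g : T -> R) :
  (1 <= p)%E -> measurable_fun setT f -> measurable_fun setT g ->
  f = g %[ae mu] -> 'N[mu]_p[EFin \o f]%E = 'N[mu]_p[EFin \o g]%E.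
Proof.
move=> p1 mf mg fg; rewrite unlock.
have mN r (h : T -> R) : measurable_fun setT h ->
    measurable_fun setT ((fun x => `|(h x)%:E| `^ r)%E : T -> \bar R).
  move=> mh; apply/measurable_EFinP.
  apply: (@measurableT_comp _ _ _ _ _ _ (@powR R ^~ r)) => //.
  exact: measurableT_comp.
case: p p1 => [r r1|_|//].
  congr (_ `^ _)%E; apply: ge0_ae_eq_integral => //.
  - exact: mN.
  - exact: mN.
  - by move=> x _; exact: poweR_ge0.
  - by move=> x _; exact: poweR_ge0.
  - by apply: filterS fg => x /= + _ => ->.
case: ifPn => // _; apply: eq_ess_sup.
by apply: filterS fg => x /= ->.
Qed.

(* The library defines [LspaceType mu p1] as a type of classes modulo a.e.
   equality but gives it no algebraic structure; it is made a normed module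
   here. *)
Section Lspace_vector.
Context d (T : measurableType d) (R : realType).
Variables (mu : {measure set T -> \bar R}) (p : \bar R) (p1 : (1 <= p)%E).

Local Notation Lf := (LfunType mu p1).
Local Notation Ls := (LspaceType mu p1).

Local Open Scope quotient_scope.

Lemma Lspace_measurable (x : Ls) : measurable_fun setT (x : T -> R).
Proof.
pose y : {mfun_ mu, T >-> measurableTypeR R} := x.
exact: (@measurable_funPT _ _ _ _ (repr y)).
Qed.

Lemma Lspace_Lfun (x : Ls) : (x : T -> R) \in Lfun mu p.
Proof.
rewrite inE; apply/andP; split; rewrite inE /=.
  exact: Lspace_measurable.
exact: Lebesgue_finite.
Qed.

Definition Lfun_of_Lspace (x : Ls) : Lf := Lfun_Sub p1 (Lspace_Lfun x).

(* The quotient is over functions into [measurableTypeR R], whose display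
   differs from that of [R]. *)
Let mfunR (f : T -> R) (mf : measurable_fun setT f) :
    {mfun T >-> measurableTypeR R} :=
  HB.pack_for {mfun T >-> measurableTypeR R} f
    (@isMeasurableFun.Build _ _ T (measurableTypeR R) f mf).

Let cls (f : Lf) : {mfun_ mu, T >-> measurableTypeR R} :=
  \pi_({mfun_ mu, T >-> measurableTypeR R})
    (mfunR (@measurable_funPT _ _ _ _ f)).

Let clsE (f : Lf) : (cls f : T -> R) = f %[ae mu].
Proof.
suff : ae_eq_op mu (repr (cls f)) (mfunR (@measurable_funPT _ _ _ _ f)).
  by move/asboolP.
by apply/eqmodP; rewrite reprK.
Qed.

Let cls_finite (f : Lf) : finite_norm mu p (cls f).
Proof.
rewrite /finite_norm (ae_eq_Lnorm p1 _ _ (clsE f)) //.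
- exact: Lfunction_finite.
- exact: (@measurable_funPT _ _ _ _ (repr (cls f))).
Qed.

Definition Lspace_of_Lfun (f : Lf) : Ls :=
  @LebesgueSpace.Pack d T R mu p p1 (cls f)
    (LebesgueSpace.Class (isFinLebesgue.Build d T R mu p p1 _ (cls_finite f))).

Lemma Lspace_of_LfunE (f : Lf) : (Lspace_of_Lfun f : T -> R) = f %[ae mu].
Proof. exact: clsE. Qed.

Lemma LspaceP (x y : Ls) : (x : T -> R) = y %[ae mu] -> x = y.
Proof.
move=> xy; have : (x : {mfun_ mu, T >-> measurableTypeR R}) = y.
  by rewrite -[LHS]reprK -[RHS]reprK; apply/eqmodP/asboolP; exact: xy.
case: x {xy} => x [[fx]]; case: y => y [[fy]] /= xy.
by subst y; rewrite (Prop_irrelevance fx fy).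
Qed.

Lemma Lfun_of_LspaceK : cancel Lfun_of_Lspace Lspace_of_Lfun.
Proof. by move=> x; apply: LspaceP; exact: Lspace_of_LfunE. Qed.

Lemma eq_Lspace_of_Lfun (f g : Lf) :
  (f : T -> R) = g %[ae mu] -> Lspace_of_Lfun f = Lspace_of_Lfun g.
Proof.
move=> fg; apply: LspaceP.
apply: ae_eq_trans (Lspace_of_LfunE f) _.
by apply: ae_eq_trans fg _; exact/ae_eq_sym/Lspace_of_LfunE.
Qed.

HB.instance Definition _ := gen_eqMixin Ls.
HB.instance Definition _ := gen_choiceMixin Ls.

Definition Lspace_add (x y : Ls) : Ls :=
  Lspace_of_Lfun (Lfun_of_Lspace x + Lfun_of_Lspace y).
Definition Lspace_opp (x : Ls) : Ls := Lspace_of_Lfun (- Lfun_of_Lspace x).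
Definition Lspace_scale (a : R) (x : Ls) : Ls :=
  Lspace_of_Lfun (a *: Lfun_of_Lspace x).

Let addE (f g : Lf) :
  Lspace_add (Lspace_of_Lfun f) (Lspace_of_Lfun g) = Lspace_of_Lfun (f + g).
Proof.
apply: eq_Lspace_of_Lfun.
by apply: filterS2 (Lspace_of_LfunE f) (Lspace_of_LfunE g) => t ft gt tT /=;
  rewrite -[LHS]/(_ t + _ t) -[RHS]/(f t + g t) ft // gt.
Qed.

Let oppE (f : Lf) : Lspace_opp (Lspace_of_Lfun f) = Lspace_of_Lfun (- f).
Proof.
apply: eq_Lspace_of_Lfun.
by apply: filterS (Lspace_of_LfunE f) => t ft tT /=;
  rewrite -[LHS]/(- _ t) -[RHS]/(- f t) ft.
Qed.

Let scaleE a (f : Lf) :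
  Lspace_scale a (Lspace_of_Lfun f) = Lspace_of_Lfun (a *: f).
Proof.
apply: eq_Lspace_of_Lfun.
by apply: filterS (Lspace_of_LfunE f) => t ft tT /=;
  rewrite -[LHS]/(a * _ t) -[RHS]/(a * f t) ft.
Qed.

Let toE (P : Ls -> Prop) : (forall f, P (Lspace_of_Lfun f)) -> forall x, P x.
Proof. by move=> Pf x; rewrite -(Lfun_of_LspaceK x). Qed.

Let addA : associative Lspace_add.
Proof.
by elim/toE => f; elim/toE => g; elim/toE => h; rewrite !addE addrA.
Qed.

Let addC : commutative Lspace_add.
Proof. by elim/toE => f; elim/toE => g; rewrite !addE addrC. Qed.

Let add0 : left_id (Lspace_of_Lfun 0) Lspace_add.
Proof. by elim/toE => f; rewrite addE add0r. Qed.

Let addN : left_inverse (Lspace_of_Lfun 0) Lspace_opp Lspace_add.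
Proof. by elim/toE => f; rewrite oppE addE addNr. Qed.

HB.instance Definition _ := GRing.isZmodule.Build Ls addA addC add0 addN.

Lemma Lspace_addE (x y : Ls) :
  ((x + y : Ls) : T -> R) = (x : T -> R) \+ y %[ae mu].
Proof. exact: (Lspace_of_LfunE (Lfun_of_Lspace x + Lfun_of_Lspace y)). Qed.

Let scaleA a b x : Lspace_scale a (Lspace_scale b x) = Lspace_scale (a * b) x.
Proof. by elim/toE: x => f; rewrite !scaleE scalerA. Qed.

Let scale1 : left_id 1 Lspace_scale.
Proof. by elim/toE => f; rewrite scaleE scale1r. Qed.

Let scaleDr : right_distributive Lspace_scale +%R.
Proof.
move=> a; elim/toE => f; elim/toE => g.
by rewrite [_ + _]addE !scaleE [RHS]addE scalerDr.
Qed.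

Let scaleDl x : {morph Lspace_scale^~ x : a b / a + b}.
Proof.
by move=> a b; elim/toE: x => f; rewrite !scaleE [RHS]addE scalerDl.
Qed.

HB.instance Definition _ :=
  GRing.Zmodule_isLmodule.Build R Ls scaleA scale1 scaleDr scaleDl.

Lemma Lspace_scalerE a (x : Ls) :
  ((a *: x : Ls) : T -> R) = a \*: (x : T -> R) %[ae mu].
Proof. exact: (Lspace_of_LfunE (a *: Lfun_of_Lspace x)). Qed.

Definition Lspace_norm (x : Ls) : R := fine 'N[mu]_p[EFin \o (x : T -> R)]%E.

Let normE (f : Lf) :
  Lspace_norm (Lspace_of_Lfun f) = fine 'N[mu]_p[EFin \o (f : T -> R)]%E.
Proof.
congr fine; apply: ae_eq_Lnorm (Lspace_of_LfunE f) => //.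
exact: Lspace_measurable.
Qed.

Let ler_normD x y : Lspace_norm (x + y) <= Lspace_norm x + Lspace_norm y.
Proof.
elim/toE: x => f; elim/toE: y => g.
rewrite [_ + _ in X in X <= _]addE !normE; exact: ler_LnormD.
Qed.

Let normZ a x : Lspace_norm (a *: x) = `|a| * Lspace_norm x.
Proof.
elim/toE: x => f; rewrite [_ *: _]scaleE !normE.
apply/EFin_inj; rewrite EFinM (finite_norm_fine (a *: f)).
by rewrite finite_norm_fine -LnormZ.
Qed.

Let norm0_eq0 x : Lspace_norm x = 0 -> x = 0.
Proof.
elim/toE: x => f; rewrite normE => /fine_Lnormr_eq0 f0.
by apply: eq_Lspace_of_Lfun; exact: f0.
Qed.

HB.instance Definition _ :=
  Lmodule_isNormed.Build R Ls ler_normD normZ norm0_eq0.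

Lemma Lspace_normE (x : Ls) : (`|x|%:E = 'N[mu]_p[EFin \o (x : T -> R)])%E.
Proof.
rewrite -[`|x|]/(Lspace_norm x) /Lspace_norm.
exact: (finite_norm_fine (Lfun_of_Lspace x)).
Qed.

End Lspace_vector.

Section sigma_finite_constructions.
Context d1 d2 (T1 : measurableType d1) (T2 : measurableType d2) (R : realType).
Variables (m1 : {sigma_finite_measure set T1 -> \bar R}).
Variables (m2 : {sigma_finite_measure set T2 -> \bar R}).

Let product_sigma_finiteT : sigma_finite setT (m1 \x m2)%E.
Proof.
have /sigma_finiteP[F [TF ndF Foo]] := sigma_finiteT m1.
have /sigma_finiteP[G [TG ndG Goo]] := sigma_finiteT m2.
exists (fun n => F n `*` G n).
  rewrite -setXTT TF TG predeqE => -[x y]; split.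
    move=> [/= [n _ Fnx] [k _ Gky]]; exists (maxn n k) => //; split.
    - by move: x Fnx; exact/subsetPset/ndF/leq_maxl.
    - by move: y Gky; exact/subsetPset/ndG/leq_maxr.
  by move=> [n _ []/= ? ?]; split; exists n.
move=> k; have [? ?] := Foo k; have [? ?] := Goo k.
split; first exact: measurableX.
by rewrite product_measure1E// lte_mul_pinfty// ge0_fin_numE.
Qed.

(* The library's canonical sigma-finite structure on [m1 \x m2] only applies to
   subprobabilities, hence the explicit packing. *)
Definition product_sfm : {sigma_finite_measure set (T1 * T2)%type -> \bar R} :=
  HB.pack_for {sigma_finite_measure set (T1 * T2)%type -> \bar R} (m1 \x m2)%E
    (Measure_isSigmaFinite.Build _ _ _ (m1 \x m2)%E product_sigma_finiteT).

Variables (D : set T1) (mD : measurable D).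

Let mrestr_sigma_finiteT : sigma_finite setT (mrestr m1 mD).
Proof.
have [F UF mF] := sigma_finiteT m1.
exists F => // k; have [mFk Fkoo] := mF k; split => //.
apply: le_lt_trans Fkoo; apply: le_measure; rewrite ?inE //.
exact: measurableI.
Qed.

Definition mrestr_sfm : {sigma_finite_measure set T1 -> \bar R} :=
  HB.pack_for {sigma_finite_measure set T1 -> \bar R} (mrestr m1 mD)
    (Measure_isSigmaFinite.Build _ _ _ (mrestr m1 mD) mrestr_sigma_finiteT).

End sigma_finite_constructions.

Section spacetime.
Variable R : realType.

Local Notation line := (measurableTypeR R).
Local Notation space := (line * line * line)%type.

Definition leb1 : {sigma_finite_measure set line -> \bar R} :=
  [the {sigma_finite_measure set line -> \bar R} of lebesgue_measure].

Definition leb3 : {sigma_finite_measure set space -> \bar R} :=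
  product_sfm (product_sfm leb1 leb1) leb1.

Definition ball3 (r : R) : set space :=
  [set x | x.1.1 ^+ 2 + x.1.2 ^+ 2 + x.2 ^+ 2 < r ^+ 2].

Lemma measurable_ball3 r : measurable (ball3 r).
Proof.
have m1 : measurable_fun setT (fun x : space => x.1.1 : R).
  exact: measurableT_comp.
have m2 : measurable_fun setT (fun x : space => x.1.2 : R).
  exact: measurableT_comp.
have m3 : measurable_fun setT (fun x : space => x.2 : R).
  exact: measurable_snd.
have mf : measurable_fun setT
    (fun x : space => (x.1.1 : R) ^+ 2 + (x.1.2 : R) ^+ 2 + (x.2 : R) ^+ 2 : R).
  by do 2?apply: measurable_funD; exact: measurable_funX.
have := mf measurableT _ (measurable_itv `]-oo, r ^+ 2[).
by rewrite setTI.
Qed.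

Definition time_measure : {sigma_finite_measure set line -> \bar R} :=
  mrestr_sfm leb1 (measurable_itv `](-1 : R), (0 : R)[).

Definition ball_measure (r : R) : {sigma_finite_measure set space -> \bar R} :=
  mrestr_sfm leb3 (measurable_ball3 r).

Definition cylinder_measure (r : R) :
    {sigma_finite_measure set (line * space)%type -> \bar R} :=
  product_sfm time_measure (ball_measure r).

Lemma threehalves_ge1 : (1 <= (3 / 2 : R)%:E)%E.
Proof. by rewrite lee_fin ler_pdivlMr// mul1r ler_nat. Qed.

End spacetime.

(* L^{3/2}((-1,0); L^{3/2}(B_r)), realised as classes of jointly measurable
   functions of (t, x); [L32_normE] identifies its norm with the mixed norm. *)
Notation L32 r := (LspaceType (cylinder_measure r) (threehalves_ge1 _)).

Lemma L32_normE (R : realType) (r : R) (q : L32 r) :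
  (`|q|%:E = Lnorm (time_measure R) (3 / 2)%:E (fun t =>
     Lnorm (ball_measure r) (3 / 2)%:E (fun x => (q (t, x))%:E)))%E.
Proof.
have p0 : (3 / 2 : R) != 0 by rewrite mulf_neq0 ?invr_neq0 ?pnatr_eq0.
rewrite Lspace_normE unlock; congr (_ `^ _)%E.
rewrite (@fubini_tonelli1 _ _ _ _ _ (time_measure R) (ball_measure r)
  (fun z => `|(q z)%:E| `^ (3 / 2))%E); last 2 first.
- apply/measurable_EFinP.
  apply: (@measurableT_comp _ _ _ _ _ _ (@powR R ^~ (3 / 2))) => //.
  apply: measurableT_comp => //; exact: Lspace_measurable.
- by move=> z; exact: poweR_ge0.
apply: eq_integral => t _.
rewrite gee0_abs ?poweR_ge0// -poweRrM mulVf// poweRe1//.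
by apply: integral_ge0 => x _; exact: poweR_ge0.
Qed.

#[short(type="normedVectType")]
HB.structure Definition NormedVector (R : numFieldType) :=
  {V of NormedModule R V & Vector R V}.

HB.instance Definition _ (K : numFieldType) m n :=
  NormedModule.on 'M[K]_(m, n).

Definition finite_rank (R : realType) (U V : lmodType R) (f : U -> V) :=
  exists s : seq V, forall u, exists c : 'I_(size s) -> R,
    f u = \sum_(i < size s) c i *: s`_i.

Lemma id_sub_linear (R : pzRingType) (U V : lmodType R) (f : {linear U -> V})
  (p : {linear V -> V}) : linear (fun u => f u - p (f u)).
Proof. by move=> a x y; rewrite !linearP addrACA -scalerDr. Qed.

Section projections.
Variables (R : pzRingType) (V1 V2 V3 V4 V5 V6 V7 : lmodType R).
Local Notation V := (V1 * V2 * V3 * V4 * V5 * V6 * V7)%type.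

Lemma proj1_linear : linear (fun x : V => x.1.1.1.1.1.1). Proof. by []. Qed.
Lemma proj2_linear : linear (fun x : V => x.1.1.1.1.1.2). Proof. by []. Qed.
Lemma proj7_linear : linear (fun x : V => x.2). Proof. by []. Qed.

Lemma tuple6_linear (U : lmodType R) (f1 : U -> V1) (f2 : U -> V2)
    (f3 : U -> V3) (f4 : U -> V4) (f5 : U -> V5) (f6 : U -> V6) :
  linear f1 -> linear f2 -> linear f3 -> linear f4 -> linear f5 -> linear f6 ->
  linear (fun u => (f1 u, f2 u, f3 u, f4 u, f5 u, f6 u)).
Proof.
by move=> l1 l2 l3 l4 l5 l6 a x y; rewrite l1 l2 l3 l4 l5 l6.
Qed.

End projections.

Section PFE.
Variable R : realType.

(* The ambient space of all tuples (p_act, p_harm, F, F_flux, E_en, G, O); the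
   spaces of the last five coordinates are arbitrary. The finite-dimensional
   package space is a [Y : vectType R] with an injective linear map [pkg] into
   this one. *)
Definition cleanPackage (VF Vflux Ven Vgate : lmodType R)
    (O : normedModType R) : lmodType R :=
  (L32 (1 / 2 : R) * L32 (3 / 4 : R) * VF * Vflux * Ven * Vgate * O)%type.

Section coordinates.
Variables (VF Vflux Ven Vgate : lmodType R) (O : normedModType R).
Local Notation package := (cleanPackage VF Vflux Ven Vgate O).

Definition pkg_act (D : package) : L32 (1 / 2 : R) := D.1.1.1.1.1.1.
Definition pkg_harm (D : package) : L32 (3 / 4 : R) := D.1.1.1.1.1.2.
Definition pkg_source (D : package) : VF := D.1.1.1.1.2.
Definition pkg_flux (D : package) : Vflux := D.1.1.1.2.
Definition pkg_en (D : package) : Ven := D.1.1.2.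
Definition pkg_gate (D : package) : Vgate := D.1.2.
Definition pkg_obs (D : package) : O := D.2.

Lemma pkg_act_is_linear : linear pkg_act. Proof. exact: proj1_linear. Qed.
Lemma pkg_harm_is_linear : linear pkg_harm. Proof. exact: proj2_linear. Qed.
Lemma pkg_obs_is_linear : linear pkg_obs. Proof. exact: proj7_linear. Qed.

HB.instance Definition _ :=
  GRing.isLinear.Build R package _ _ pkg_act pkg_act_is_linear.
HB.instance Definition _ :=
  GRing.isLinear.Build R package _ _ pkg_harm pkg_harm_is_linear.
HB.instance Definition _ :=
  GRing.isLinear.Build R package _ _ pkg_obs pkg_obs_is_linear.

End coordinates.

Record pfeDetector (Y : vectType R) (Zflux Zen Zgate : normedVectType R) :=
  PfeDetector {
    Pi_prs : {linear L32 (1 / 2 : R) -> L32 (1 / 2 : R)};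
    Pi_prs_finite_rank : finite_rank Pi_prs;
    Pi_harm : {linear L32 (3 / 4 : R) -> L32 (3 / 4 : R)};
    Pi_harm_finite_rank : finite_rank Pi_harm;
    T_flux : {linear Y -> Zflux};
    T_en : {linear Y -> Zen};
    T_gate : {linear Y -> Zgate};
    beta_prs : R;
    beta_harm : R;
    beta_flux : R;
    beta_en : R;
    beta_gate : R
  }.

Section detector.
Variables (VF Vflux Ven Vgate : lmodType R) (O : normedModType R).
Variables (Zflux Zen Zgate : normedVectType R) (Y : vectType R).
Variables (pkg : {linear Y -> cleanPackage VF Vflux Ven Vgate O}).
Variable P : pfeDetector Y Zflux Zen Zgate.
Implicit Type D : Y.

Definition O_cl D : O := pkg_obs (pkg D).
Definition T_prs D : L32 (1 / 2 : R) :=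
  pkg_act (pkg D) - Pi_prs P (pkg_act (pkg D)).
Definition T_harm D : L32 (3 / 4 : R) :=
  pkg_harm (pkg D) - Pi_harm P (pkg_harm (pkg D)).

Definition pfe_channels D : seq R :=
  [:: `|O_cl D|; `|T_prs D|; `|T_harm D|;
      `|T_flux P D|; `|T_en P D|; `|T_gate P D|].

Definition M_pfe D : R :=
  `|O_cl D| + beta_prs P * `|T_prs D| + beta_harm P * `|T_harm D|
  + beta_flux P * `|T_flux P D| + beta_en P * `|T_en P D|
  + beta_gate P * `|T_gate P D|.

Definition Z_pfe : lmodType R :=
  (O * L32 (1 / 2 : R) * L32 (3 / 4 : R) * Zflux * Zen * Zgate)%type.

Definition T_pfe D : Z_pfe :=
  (O_cl D, T_prs D, T_harm D, T_flux P D, T_en P D, T_gate P D).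

Lemma T_pfe_is_linear : linear T_pfe.
Proof.
have O_lin : linear O_cl by move=> a x y; rewrite /O_cl !linearP.
pose act : {linear Y -> L32 (1 / 2 : R)} :=
  [the {linear Y -> _} of @pkg_act _ _ _ _ _ \o pkg].
pose harm : {linear Y -> L32 (3 / 4 : R)} :=
  [the {linear Y -> _} of @pkg_harm _ _ _ _ _ \o pkg].
have prs_lin : linear T_prs := id_sub_linear act (Pi_prs P).
have harm_lin : linear T_harm := id_sub_linear harm (Pi_harm P).
exact: (tuple6_linear O_lin prs_lin harm_lin (linearP (T_flux P))
  (linearP (T_en P)) (linearP (T_gate P))).
Qed.

HB.instance Definition _ := GRing.isLinear.Build R Y Z_pfe *:%R T_pfe
  T_pfe_is_linear.

End detector.
End PFE.

(* Main.v *)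
Require Import Defs.
From HB Require Import structures.
From mathcomp Require Import all_boot all_order all_algebra.
From mathcomp Require Import all_classical all_reals ereal topology normedtype.
From mathcomp Require Import measure lebesgue_measure lebesgue_integral hoelder.

Set Implicit Arguments.
Unset Strict Implicit.
Unset Printing Implicit Defensive.

Import Order.TTheory GRing.Theory Num.Theory.
Import numFieldNormedType.Exports.

Local Open Scope classical_set_scope.
Local Open Scope ring_scope.

(** The detector is a sum of norms with positive weights (weight one on the observation channel),
    and the channels inside these norms are exactly the components of [T_pfe]. A vanishing sum of
    nonnegative terms forces each term to vanish; since norms are definite, also on the $L^{3/2}$
    spaces of classes modulo null sets, every component is zero ([weighted_norm_sum6_eq0]). So the
    package lies in the kernel, which is [G] by hypothesis. *)

Lemma weighted_norm_eq0 (R : numFieldType) (V : normedModType R) (b : R)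
    (v : V) :
  0 < b -> (b * `|v| == 0) = (v == 0).
Proof. by move=> b0; rewrite mulf_eq0 gt_eqF//= normr_eq0. Qed.

(** The conclusion is one equality of tuples so that it unfolds to the vanishing of [T_pfe]. *)
Lemma weighted_norm_sum6_eq0 (R : numFieldType)
    (V1 V2 V3 V4 V5 V6 : normedModType R) (b2 b3 b4 b5 b6 : R)
    (v1 : V1) (v2 : V2) (v3 : V3) (v4 : V4) (v5 : V5) (v6 : V6) :
  0 < b2 -> 0 < b3 -> 0 < b4 -> 0 < b5 -> 0 < b6 ->
  `|v1| + b2 * `|v2| + b3 * `|v3| + b4 * `|v4| + b5 * `|v5| + b6 * `|v6| = 0 ->
  (v1, v2, v3, v4, v5, v6) = (0, 0, 0, 0, 0, 0).
Proof.
move=> b2_gt0 b3_gt0 b4_gt0 b5_gt0 b6_gt0 /eqP.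
(* Splitting off the last summand each time requires the remaining partial sum to be nonnegative. *)
rewrite !paddr_eq0 ?addr_ge0 ?mulr_ge0 ?normr_ge0 ?ltW//.
rewrite !weighted_norm_eq0// normr_eq0.
by move=> /andP[/andP[/andP[/andP[/andP[]]]]] /eqP-> /eqP-> /eqP-> /eqP->
  /eqP-> /eqP->.
Qed.

Theorem theorem12p21 (R : realType)
    (VF Vflux Ven Vgate : lmodType R) (O : normedModType R)
    (Zflux Zen Zgate : normedVectType R)
    (Y : vectType R) (pkg : {linear Y -> cleanPackage VF Vflux Ven Vgate O})
    (pkg_inj : injective pkg)
    (G : {vspace Y})
    (P : pfeDetector Y Zflux Zen Zgate)
    (channels_ge0 : forall (D : Y) (c : R), c \in pfe_channels pkg P D -> 0 <= c)
    (beta_prs_gt0 : 0 < beta_prs P)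
    (beta_harm_gt0 : 0 < beta_harm P)
    (beta_flux_gt0 : 0 < beta_flux P)
    (beta_en_gt0 : 0 < beta_en P)
    (beta_gate_gt0 : 0 < beta_gate P)
    (ker_T_pfe : T_pfe pkg P @^-1` [set 0] = [set` G]) :
  (forall D : Y, M_pfe pkg P D = 0 -> D \in G) /\
  [set D : Y | M_pfe pkg P D = 0] `<=` [set` G].
Proof.
have MG D : M_pfe pkg P D = 0 -> D \in G.
  (* Membership is restated for sets because the kernel hypothesis is an equality of sets. *)
  move=> MD0; suff : [set` G] D by [].
  by rewrite -ker_T_pfe; exact: weighted_norm_sum6_eq0 MD0.
by split=> // D; exact: MG.
Qed.
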